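(* Let $X$ be a real or complex Banach space with $\dim X=\infty$, and let $T:X\to X$ be a linear isometry. Then there is no compact set $K\subseteq X$ that is occasionally attracting for $T$; that is, there is no compact set $K\subseteq X$ such that $$\liminf_{n\to\infty}\rho(T^n x,K)=0\quad\text{for every } x\in X \text{ with } \|x\|\le 1 .$$
   Context: For $x\in X$ and $Y\subseteq X$, $\rho(x,Y)=\inf_{y\in Y}\|x-y\|$ denotes the distance from $x$ to $Y$. *)

(* Defs.v *)
From HB Require Import structures.
From mathcomp Require Import all_boot all_order all_algebra.
From mathcomp Require Import complex.
From mathcomp Require Import all_classical all_reals all_analysis.
Set Implicit Arguments.
Unset Strict Implicit.
Unset Printing Implicit Defensive.
Import Order.TTheory GRing.Theory Num.Theory numFieldNormedType.Exports.
Local Open Scope classical_set_scope.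
Local Open Scope ring_scope.

Definition finite_dimensional (K : numFieldType) (V : lmodType K) : Prop :=
  exists (n : nat) (e : 'I_n -> V),
    forall v : V, exists a : 'I_n -> K, v = \sum_(i < n) a i *: e i.

Definition linear_isometry (K : numFieldType) (X : normedModType K)
    (T : {linear X -> X}) : Prop :=
  forall x : X, `|T x| = `|x|.

(* The norm of a [normedModType K] takes its values in [K] itself, also when   *)
(* [K] is the field of complex numbers.  The map [re : K -> R] turns it into a *)
(* real number: it is the identity for [K = R] and the real part, which loses  *)
(* nothing on the (real, nonnegative) values of the norm, for [K = R[i]].      *)

(* The infimum is taken in the extended reals, so that [rho re x set0 = +oo]   *)
(* and the empty set is not occasionally attracting.                           *)
Definition rho (R : realType) (K : numFieldType) (re : K -> R)
    (X : normedModType K) (x : X) (Y : set X) : \bar R :=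
  ereal_inf [set (re `|x - y|)%:E | y in Y].

Definition occasionally_attracting (R : realType) (K : numFieldType)
    (re : K -> R) (X : normedModType K) (T : X -> X) (A : set X) : Prop :=
  forall x : X, `|x| <= 1 ->
    limn_einf (fun n : nat => rho re (iter n T x) A) = 0%E.

(* Main.v *)
Require Import Defs.
From HB Require Import structures.
From mathcomp Require Import all_boot all_order all_algebra.
From mathcomp Require Import complex.
From mathcomp Require Import all_classical all_reals all_analysis.
From mathcomp Require Import ring lra.
Set Implicit Arguments.
Unset Strict Implicit.
Unset Printing Implicit Defensive.
Import Order.TTheory GRing.Theory Num.Theory numFieldNormedType.Exports.
Local Open Scope classical_set_scope.
Local Open Scope ring_scope.

(* Suppose the compact set A is occasionally attracting. A limit point of the
   T^n x in A together with |T x| = |x| shows that every x is recurrent: T^n x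
   is close to x for some n > 0. Put th = 2 pi j / n, v_j = \sum_(k < n)
   cos (k th) T^k x and q(T) = T^2 - 2 cos th T + 1. Then q(T) v_j =
   (1 - cos th T) (x - T^n x) is small, while the average of the v_j is x, so
   some v_j is at least as far as x from a given subspace M. Suppose T M = M and
   M is finite-dimensional and proper; approximating the iterates of a rescaled v_j modulo M
   by points of A and passing to the limit gives a in A with dist(a, M) >= 1/4
   and T^2 a + a in M + R T a, so M + R a + R T a is again mapped onto itself.
   If dim X is infinite this never stops, and it produces infinitely many points
   of A at mutual distances >= 1/4. Only real scalars occur, so a complex space
   is treated as a real one. *)

(** * Cosine sums and real sequences *)

(** Multiplied by 2 sin h with h = pi k / n, the sum telescopes. At m = n the end term is sin (2 pi
    k - h) = - sin h and cancels the initial one, while 0 < k < n gives sin h > 0. *)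
Lemma sum_cos_roots_of_unity (R : realType) (n k : nat) :
  (0 < k < n)%N -> \sum_(j < n) cos ((pi *+ 2 * j%:R / n%:R) *+ k) = 0 :> R.
Proof.
move=> /andP[k0 kn].
have n0 : (n%:R : R) != 0 by rewrite pnatr_eq0 -lt0n (ltn_trans k0).
pose h : R := pi * k%:R / n%:R.
have sh : sin h != 0.
  rewrite gt_eqF// sin_gt0_pi// /h.
  have n1 : (0 : R) < n%:R by rewrite ltr0n (ltn_trans k0).
  rewrite !(divr_gt0, mulr_gt0) ?pi_gt0 ?(ltr0n _ k)//=.
  by rewrite ltr_pdivrMr// ltr_pM2l ?pi_gt0// ltr_nat.
have tele m : 2 * sin h * (\sum_(j < m) cos ((pi *+ 2 * j%:R / n%:R) *+ k)) =
    sin (h * (2 * m%:R - 1)) + sin h.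
  elim: m => [|m IH].
    by rewrite big_ord0 mulr0 mulr0 sub0r mulrN1 sinN addNr.
  rewrite big_ord_recr/= mulrDr IH.
  have -> : (pi *+ 2 * m%:R / n%:R) *+ k = h * (2 * m%:R) :> R.
    by rewrite /h -mulr_natr -mulr_natr; field.
  have -> : h * (2 * m%:R - 1) = h * (2 * m%:R) - h by ring.
  have -> : h * (2 * m.+1%:R - 1) = h * (2 * m%:R) + h by rewrite -natr1; ring.
  by rewrite sinB sinD; ring.
have := tele n.
have -> : h * (2 * n%:R - 1) = - h + (pi *+ 2) *+ k.
  by rewrite /h -mulr_natr -(mulr_natr _ k); field.
rewrite (periodicn (@sinD2pi R)) sinN addNr => /eqP.
by rewrite !mulf_eq0 (negbTE sh) pnatr_eq0 /= => /eqP.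
Qed.

Lemma bounded_seq_cluster (R : realType) (t : nat -> R) (b : R) :
  (forall k, `|t k| <= b) ->
  exists l, forall e : R, 0 < e ->
    forall n, exists2 k, (n <= k)%N & `|t k - l| < e.
Proof.
move=> tb.
have [|l [_ cl]] := @segment_compact R (- b) b (t @ \oo) _.
  by exists 0%N => // k _ /=; rewrite in_itv/= -ler_norml.
exists l => e e0 n.
have [] := cl [set t k | k in [set k | (n <= k)%N]] (ball l e).
- by exists n => // k /= nk; exists k.
- exact: nbhsx_ballx.
by move=> x [[k /= nk <-]]; rewrite /ball /= distrC; exists k.
Qed.

Lemma natSinv_lt (R : realType) (e : R) : 0 < e ->
  exists K : nat, forall k, (K <= k)%N -> k.+1%:R^-1 < e.
Proof.
by move=> e0; have [K _ KP] := near_infty_natSinv_lt (PosNum e0); exists K.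
Qed.

(** * Finite-dimensional closed subspaces of a real normed space *)

Section Core.
Variables (R : realType) (V : lmodType R) (N : V -> R).
Hypothesis ND : forall x y, N (x + y) <= N x + N y.
Hypothesis NZ : forall r x, N (r *: x) = `|r| * N x.
Hypothesis N0_eq0 : forall x, N x = 0 -> x = 0.

Let N0 : N 0 = 0.
Proof. by rewrite -(scale0r 0) NZ normr0 mul0r. Qed.

Let NN x : N (- x) = N x.
Proof. by rewrite -scaleN1r NZ normrN1 mul1r. Qed.

Let N_ge0 x : 0 <= N x.
Proof. by have := ND x (- x); rewrite subrr N0 NN; lra. Qed.

Let NB x y : N (x - y) = N (y - x).
Proof. by rewrite -NN opprB. Qed.

Let NBD x y z : N (x - z) <= N (x - y) + N (y - z).
Proof. by apply: le_trans (ND _ _); rewrite addrA subrK. Qed.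

Let Nsum (I : finType) (F : I -> V) : N (\sum_i F i) <= \sum_i N (F i).
Proof.
elim/big_rec2: _ => [|i y z _ h]; first by rewrite N0.
by apply: le_trans (ND _ _) _; rewrite lerD2l.
Qed.

(* Closedness is sequential, with respect to N: V carries no topology. *)
Record fin_subspace (M : set V) : Prop := FinSubspace {
  fsub0 : M 0;
  fsubL : forall r x y, M x -> M y -> M (r *: x + y);
  fsub_closed : forall x,
    (forall e : R, 0 < e -> exists2 m, M m & N (x - m) < e) -> M x;
  fsub_span : exists (n : nat) (e : 'I_n -> V),
    forall x, M x -> exists a : 'I_n -> R, x = \sum_i a i *: e i }.

Definition far (d : R) (x : V) (M : set V) := forall m, M m -> d <= N (x - m).

Definition add_line (M : set V) (a : V) := [set x | exists t, M (x - t *: a)].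

Section Fsub.
Variables (M : set V) (fM : fin_subspace M).

Lemma fsubZ r x : M x -> M (r *: x).
Proof.
by move=> Mx; rewrite -[_ *: _]addr0; apply: fsubL => //; exact: fsub0.
Qed.

Lemma fsubD x y : M x -> M y -> M (x + y).
Proof. by move=> Mx My; rewrite -[x]scale1r; exact: fsubL. Qed.

Lemma fsubB x y : M x -> M y -> M (x - y).
Proof.
by move=> Mx My; apply: fsubD => //; rewrite -scaleN1r; exact: fsubZ.
Qed.

Lemma fsub_sum (I : finType) (F : I -> V) :
  (forall i, M (F i)) -> M (\sum_i F i).
Proof.
move=> MF; elim/big_rec: _ => [|i x _ Mx]; first exact: fsub0.
exact: fsubD.
Qed.

Lemma far_of_notin x : ~ M x -> exists2 d : R, 0 < d & far d x M.
Proof.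
move=> nMx; apply: contrapT => H; apply: nMx; apply: (fsub_closed fM) => e e0.
apply: contrapT => H'; apply: H; exists e => // m Mm.
by rewrite leNgt; apply/negP => lt; apply: H'; exists m.
Qed.

Lemma sub_add_line a x : M x -> add_line M a x.
Proof. by exists 0; rewrite scale0r subr0. Qed.

Lemma mem_add_line a : add_line M a a.
Proof. by exists 1; rewrite scale1r subrr; exact: fsub0. Qed.

(** Let m_k + t_k a approach x with m_k in M. Since [a] has distance at least d > 0 from M, |t_k| d
    <= N (t_k a + m_k) stays bounded. For a cluster value l of the t_k, x - l a is a limit of points
    of M. *)
Lemma add_line_closed a x : ~ M a ->
  (forall e : R, 0 < e -> exists2 m, add_line M a m & N (x - m) < e) ->
  add_line M a x.
Proof.
move=> /far_of_notin[d d0 fard] adh.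
have /choice[t tP] : forall k : nat, exists t,
    exists2 m, M m & N (x - t *: a - m) < k.+1%:R^-1.
  move=> k; have [|y [t Mt] h] := adh k.+1%:R^-1; first by rewrite invr_gt0.
  by exists t, (y - t *: a) => //; rewrite opprB addrA subrK.
have tb k : `|t k| <= (N x + 1) / d.
  rewrite ler_pdivlMr//; have [m Mm h] := tP k.
  have h1 : k.+1%:R^-1 <= 1 :> R by rewrite invf_le1// ler1n.
  have [->|tk0] := eqVneq (t k) 0.
    by rewrite normr0 mul0r; have := N_ge0 x; lra.
  (* The distance of [a] to the point - m / t_k of M, scaled by |t_k|. *)
  have /(ler_wpM2l (normr_ge0 (t k))) := fard (- (t k)^-1 *: m) (fsubZ _ Mm).
  rewrite -NZ scalerBr scalerA mulrN divff// scaleN1r opprK => h2.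
  have := ND x (- (x - t k *: a - m)).
  rewrite NN opprB opprB addrCA (addrC x) subrK (addrC m) => h3.
  by have := lt_le_trans h h1; lra.
have [l lP] := bounded_seq_cluster tb.
exists l; apply: (fsub_closed fM) => e e0.
have Na := N_ge0 a.
have [|K KP] := @natSinv_lt R (e / 2); first by rewrite divr_gt0.
have [|k nk tl] := lP (e / 2 / (N a + 1)) _ K.
  by rewrite !divr_gt0//; lra.
have [m Mm h] := tP k; exists m => //.
have := NBD (x - l *: a) (x - t k *: a) m.
have -> : x - l *: a - (x - t k *: a) = (t k - l) *: a.
  by rewrite opprB addrC addrA subrK scalerBl.
rewrite NZ.
have : `|t k - l| * N a <= e / 2.
  rewrite ltr_pdivlMr in tl; last lra.
  by have := normr_ge0 (t k - l); nra.
have := lt_trans h (KP k nk); lra.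
Qed.

Lemma add_line_fin_subspace a : fin_subspace (add_line M a).
Proof.
have [Ma|nMa] := pselect (M a).
  suff -> : add_line M a = M by [].
  apply/seteqP; split=> x; last exact: sub_add_line.
  by case=> t Mt; rewrite -(subrK (t *: a) x); apply: fsubD => //; exact: fsubZ.
split.
- exact/sub_add_line/(fsub0 fM).
- move=> r x y [s Ms] [t Mt]; exists (r * s + t).
  have -> : r *: x + y - (r * s + t) *: a = r *: (x - s *: a) + (y - t *: a).
    by rewrite scalerDl opprD addrACA scalerBr scalerA.
  exact: fsubL.
- by move=> x; exact: add_line_closed.
- have [n [e eP]] := fsub_span fM.
  exists n.+1, (fun i => oapp e a (unlift ord0 i)) => x [t /eP[c cE]].
  exists (fun i => oapp c t (unlift ord0 i)).
  rewrite big_ord_recl unlift_none/= -[x](subrK (t *: a)) cE addrC.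
  by congr (_ + _); apply: eq_bigr => i _; rewrite liftK.
Qed.

(** Riesz's lemma: s is the distance from x to M, and m is chosen with N (x - m) < 2 s. The bound d
    <= s is kept to control the factor 1 / (2 s) later. *)
Lemma riesz x (d : R) : 0 < d -> far d x M -> exists (s : R) m,
  [/\ d <= s, M m, N ((2 * s)^-1 *: (x - m)) <= 1
    & far (1 / 2) ((2 * s)^-1 *: (x - m)) M].
Proof.
move=> d0 fard; pose D := [set N (x - m) | m in M].
have D0 : D !=set0 by exists (N (x - 0)), 0 => //; exact: fsub0.
have lbD : lbound D d by move=> _ [m Mm <-]; exact: fard.
have hD : has_inf D by split=> //; exists d.
have dD : d <= inf D by apply: lb_le_inf.
have s0 : 0 < inf D by exact: lt_le_trans dD.
have [_ [m Mm <-] mlt] := inf_adherent s0 hD.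
have s2 : 0 < 2 * inf D by rewrite mulr_gt0.
exists (inf D), m; split => //.
  by rewrite NZ gtr0_norm ?invr_gt0// ler_pdivrMl//; lra.
move=> m' Mm'.
have -> : (2 * inf D)^-1 *: (x - m) - m' =
    (2 * inf D)^-1 *: (x - (m + (2 * inf D) *: m')).
  by rewrite opprD addrA [RHS]scalerBr scalerA mulVf ?gt_eqF// scale1r.
rewrite NZ gtr0_norm ?invr_gt0// ler_pdivlMl//.
have -> : 2 * inf D * (1 / 2) = inf D by field.
apply: ge_inf; first by exists d.
by exists (m + (2 * inf D) *: m') => //; apply: fsubD => //; exact: fsubZ.
Qed.

End Fsub.

Lemma set0_fin_subspace : fin_subspace [set 0].
Proof.
split=> //.
- by move=> r x y -> ->; rewrite scaler0 addr0.
- move=> x H; apply: N0_eq0; apply/eqP; rewrite eq_le N_ge0 andbT leNgt.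
  by apply/negP => /H[m ->]; rewrite subr0 ltxx.
- exists 0%N, (fun=> 0) => x ->; exists (fun=> 0); by rewrite big_ord0.
Qed.

(** * Cosine sums along an orbit of the isometry *)

Variable T : {linear V -> V}.
Hypothesis NT : forall x, N (T x) = N x.

Lemma N_iter k x : N (iter k T x) = N x.
Proof. by elim: k => //= k IH; rewrite NT. Qed.

Lemma iterB k x y : iter k T (x - y) = iter k T x - iter k T y.
Proof. by elim: k => //= k ->; rewrite linearB. Qed.

Lemma iterZ k r x : iter k T (r *: x) = r *: iter k T x.
Proof. by elim: k => //= k ->; rewrite linearZ. Qed.

(** If T^n x = x and th = 2 pi j / n, this is, up to a factor, a real discrete Fourier component of
    the orbit, killed by T^2 - 2 cos th T + 1. *)
Definition cos_sum n (th : R) x := \sum_(k < n) cos (th *+ k) *: iter k T x.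

(* The recurrence cos((k+1)th) + cos((k-1)th) = 2 cos th cos(k th) leaves only
   boundary terms. *)
Lemma quad_cos_sum n th x :
  T (T (cos_sum n th x)) + cos_sum n th x =
  (2 * cos th) *: T (cos_sum n th x) + (x - cos th *: T x)
  - cos (th *+ n) *: iter n T x + cos (th *+ n - th) *: iter n.+1 T x.
Proof.
elim: n => [|n IH].
  rewrite /cos_sum big_ord0 !linear0 !add0r mulr0n cos0 ?sub0r cosN/=.
  by rewrite scale1r [RHS]addrAC subrK subrr.
have E : cos_sum n.+1 th x = cos_sum n th x + cos (th *+ n) *: iter n T x.
  by rewrite /cos_sum big_ord_recr.
have cE : cos (th *+ n.+1) = 2 * cos th * cos (th *+ n) - cos (th *+ n - th).
  by rewrite mulrS cosB cosD; ring.
have -> : th *+ n.+1 - th = th *+ n by rewrite mulrSr addrK.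
rewrite E cE !(linearD T) !(linearZ_LR T) addrACA IH scalerDr scalerBl scalerA.
set q := cos (th *+ n) *: iter n T x.
set b := (2 * cos th * cos (th *+ n)) *: T (iter n T x).
set r := cos (th *+ n - th) *: _; set s := cos (th *+ n) *: _.
set a := _ *: T _; set y := x - _.
rewrite (addrAC _ (- q)) addrA (addrAC _ s) subrK opprB.
by rewrite (addrAC a b) (addrA _ r) (addrAC _ r (- b)) addrK.
Qed.

(** After exchanging the sums only k = 0 survives, contributing x once for each j. *)
Lemma sum_cos_sum n x :
  \sum_(j < n) cos_sum n (pi *+ 2 * j%:R / n%:R) x = n%:R *: x.
Proof.
case: n => [|n]; first by rewrite big_ord0 scale0r.
rewrite /cos_sum exchange_big/= big_ord_recl/= [X in _ + X]big1 => [|k _].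
  rewrite addr0 (eq_bigr (fun=> x)) => [|j _].
    by rewrite sumr_const card_ord scaler_nat.
  by rewrite mulr0n cos0 scale1r.
by rewrite -scaler_suml sum_cos_roots_of_unity ?scale0r//= ltnS ltn_ord.
Qed.

(** For c = 2 cos th the polynomial has roots e^(i th) and e^(- i th); its kernel replaces complex
    eigenvectors over the reals. *)
Definition quad (c : R) x := T (T x) + x - c *: T x.

Lemma quadB c x y : quad c (x - y) = quad c x - quad c y.
Proof.
rewrite /quad !(linearB T) scalerBr addrACA -opprD !opprB.
set p := T (T x) + x; set q := T (T y) + y.
rewrite -[LHS]addrA -[RHS]addrA; congr (_ + _).
by rewrite [LHS]addrCA [RHS]addrCA (addrC (- q)).
Qed.

Lemma quadZ c r x : quad c (r *: x) = r *: quad c x.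
Proof. by rewrite /quad !(linearZ_LR T) scalerBr scalerDr !scalerA mulrC. Qed.

Lemma quad_iter c k x : quad c (iter k T x) = iter k T (quad c x).
Proof.
by elim: k => //= k <-; rewrite /quad (linearB T) (linearD T) (linearZ_LR T).
Qed.

Lemma N_quad c x : `|c| <= 2 -> N (quad c x) <= 4 * N x.
Proof.
move=> c2; have := ND (T (T x) + x) (- (c *: T x)).
have := ND (T (T x)) x; rewrite NN NZ !NT -/(quad c x).
by have := N_ge0 x; nra.
Qed.

(** * Recurrence and approximate kernel vectors *)

Variable A : set V.
Hypothesis A_cluster : forall u : nat -> V, (forall n, A (u n)) ->
  exists2 a, A a &
    forall e : R, 0 < e -> forall n, exists2 k, (n <= k)%N & N (u k - a) < e.
Hypothesis A_attr : forall x, N x <= 1 -> forall e : R, 0 < e -> forall n,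
  exists k a, [/\ (n <= k)%N, A a & N (iter k T x - a) < e].

(** Two iterates of x at different times lie within e / 2 of one limit point in A. The earlier power
    of T is an isometry and can be cancelled from their difference. *)
Lemma recurrence x (e : R) : N x <= 1 -> 0 < e ->
  exists n : nat, (0 < n)%N /\ N (iter n T x - x) < e.
Proof.
move=> x1 e0; have e4 : 0 < e / 4 by rewrite divr_gt0.
have /choice[p pP] : forall j, exists p : nat * V,
    [/\ (j <= p.1)%N, A p.2 & N (iter p.1 T x - p.2) < e / 4].
  by move=> j; have [k [a [? ? ?]]] := A_attr x1 e4 j; exists (k, a).
have [|a _ aP] := A_cluster (u := fun j => (p j).2).
  by move=> j; have [] := pP j.
(* The index j is taken beyond the time attached to i, so the second time is strictly later. *)
have [i _ iP] := aP _ e4 0%N; have [j ij jP] := aP _ e4 (p i).1.+1.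
have [_ _ pi] := pP i; have [jk _ pj] := pP j.
have ijk : ((p i).1 < (p j).1)%N by exact: leq_trans ij jk.
exists ((p j).1 - (p i).1)%N; split; first by rewrite subn_gt0.
rewrite -(N_iter (p i).1) iterB -iterD subnKC ?(ltnW ijk)//.
have := NBD (iter (p j).1 T x) (p j).2 (iter (p i).1 T x).
have := NBD (p j).2 a (iter (p i).1 T x).
have := NBD a (p i).2 (iter (p i).1 T x).
by rewrite (NB a (p i).2) (NB (p i).2 (iter _ _ _)); lra.
Qed.

Lemma far_quad_small M x (e : R) : fin_subspace M -> N x <= 1 ->
  far (1 / 2) x M -> 0 < e ->
  exists (c : R) v, [/\ `|c| <= 2, far (1 / 2) v M & N (quad c v) < e].
Proof.
move=> fM x1 farx e0.
have e2 : 0 < e / 2 by rewrite divr_gt0.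
have [n [n0 nP]] := recurrence x1 e2.
have nR : 0 < n%:R :> R by rewrite ltr0n.
pose th (j : 'I_n) : R := pi *+ 2 * j%:R / n%:R.
have [j farj] : exists j, far (1 / 2) (cos_sum n (th j) x) M.
  (* If every cosine sum were within 1/2 of some m_j in M, the average of the m_j would be within
     1/2 of x, the average of the cosine sums. *)
  apply: contrapT => H.
  have /choice[m mP] : forall j, exists m,
      M m /\ N (cos_sum n (th j) x - m) < 1 / 2.
    move=> j; apply: contrapT => H'; apply: H; exists j => m Mm.
    by rewrite leNgt; apply/negP => lt; apply: H'; exists m.
  have Mm : M (n%:R^-1 *: \sum_j m j).
    by apply: fsubZ => //; apply: fsub_sum => // i; case: (mP i).
  have := farx _ Mm.
  have -> : x - n%:R^-1 *: \sum_j m j =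
      n%:R^-1 *: \sum_j (cos_sum n (th j) x - m j).
    rewrite sumrB sum_cos_sum scalerBr scalerA mulVf ?scale1r//.
    by rewrite gt_eqF.
  rewrite NZ gtr0_norm ?invr_gt0// ler_pdivlMl//.
  rewrite leNgt => /negP; apply.
  apply: le_lt_trans (Nsum _) _.
  have -> : n%:R * (1 / 2) = \sum_(j < n) (1 / 2) :> R.
    by rewrite sumr_const card_ord mulr_natl.
  apply: ltr_sum; last by move=> i _; case: (mP i).
  by apply/hasP; exists (Ordinal n0); rewrite ?mem_index_enum.
exists (2 * cos (th j)), (cos_sum n (th j) x); split => //.
  by rewrite normrM gtr0_norm// ler_piMr// cos_max.
(* As n th is a multiple of 2 pi, the boundary terms of [quad_cos_sum] combine into (1 - cos th T)
   (x - T^n x), of norm at most 2 N (x - T^n x). *)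
have per : th j *+ n = 0 + (pi *+ 2) *+ j.
  rewrite add0r /th -[LHS]mulr_natr -[RHS]mulr_natr -[LHS]mulrA mulVf ?mulr1//.
  by rewrite gt_eqF.
have c1 : cos (th j *+ n) = 1 by rewrite per (periodicn (@cosD2pi R)) cos0.
have c2 : cos (th j *+ n - th j) = cos (th j).
  by rewrite per addrAC (periodicn (@cosD2pi R)) sub0r cosN.
have -> : quad (2 * cos (th j)) (cos_sum n (th j) x) =
    (x - iter n T x) - cos (th j) *: T (x - iter n T x).
  rewrite /quad quad_cos_sum c1 c2 scale1r.
  set a := _ *: T (cos_sum _ _ _).
  rewrite -!(addrA a) [LHS]addrC subrK (linearB T) scalerBr opprB.
  by rewrite (addrAC x) -[LHS]addrA (addrC (- (_ *: T x))).
have := ND (x - iter n T x) (- (cos (th j) *: T (x - iter n T x))).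
rewrite NN NZ NT => /le_lt_trans; apply; rewrite NB in nP.
by have := cos_max (th j); have := N_ge0 (x - iter n T x); nra.
Qed.

(** * Invariant subspaces and their extension *)

(** Surjectivity on M makes T preserve lower bounds on the distance to M: each m in M is some T y
    with y in M, and N (T x - T y) = N (x - y). *)
Record tame (M : set V) : Prop := Tame {
  tame_fin : fin_subspace M;
  tame_inv : forall x, M x -> M (T x);
  tame_onto : forall x, M x -> exists2 y, M y & T y = x }.

Section Step.
Variables (M : set V) (tM : tame M).
Let fM := tame_fin tM.

Lemma tame_iter k x : M x -> M (iter k T x).
Proof. by move=> Mx; elim: k => //= k; exact: tame_inv. Qed.

Lemma far_iter k d x : far d x M -> far d (iter k T x) M.
Proof.
elim: k => //= k IH farx m /(tame_onto tM)[y My <-].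
by rewrite -linearB NT; exact: IH.
Qed.

(** [riesz] is applied twice: to z, since recurrence needs a vector of the unit ball, and to the
    resulting v, whose norm is not controlled. The second use has 2 s >= 1, so rescaling does not
    enlarge [quad c v]; the subtracted part only contributes a term in M. *)
Lemma approx_quad_point z (e : R) : ~ M z -> 0 < e -> exists (c : R) a m,
  [/\ `|c| <= 2, A a, far (1 / 2 - e) a M, M m & N (quad c a - m) < e].
Proof.
move=> /(far_of_notin fM)[d d0 farz] e0.
have [s0 [m0 [ds0 Mm0]]] := riesz fM d0 farz.
set x := _ *: _ => x1 farx.
have e2 : 0 < e / 2 by rewrite divr_gt0.
have [c [v [c2 farv Nv]]] := far_quad_small fM x1 farx e2.
have [|s [m [ds Mm]]] := riesz fM _ farv; first by rewrite divr_gt0.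
set y := _ *: _ => y1 fary.
(* [quad c] multiplies norms by at most 4, so replacing the iterate by [a] costs less than e / 2. *)
have e8 : 0 < e / 8 by rewrite divr_gt0.
have [k [a [_ Aa Na]]] := A_attr y1 e8 0%N.
exists c, a, (- iter k T ((2 * s)^-1 *: quad c m)).
have Mq : M (quad c m).
  apply: fsubB => //; last by apply: fsubZ => //; exact: tame_inv.
  by apply: fsubD => //; do !apply: tame_inv => //.
split => //.
- move=> b Mb; have := far_iter k fary Mb; have := NBD (iter k T y) a b.
  by lra.
- by rewrite -scaleN1r; apply: fsubZ => //; apply: tame_iter; exact: fsubZ.
have qy : iter k T (quad c y) =
    (2 * s)^-1 *: iter k T (quad c v) - iter k T ((2 * s)^-1 *: quad c m).
  by rewrite -iterZ -iterB -scalerBr -quadB quadZ.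
rewrite opprK.
have -> : quad c a + iter k T ((2 * s)^-1 *: quad c m) =
    (2 * s)^-1 *: iter k T (quad c v) - quad c (iter k T y - a).
  by rewrite quadB quad_iter qy !opprB [RHS]addrC addrA subrK.
apply: le_lt_trans (ND _ _) _; rewrite NN NZ N_iter.
have := N_quad (iter k T y - a) c2.
have s1 : 1 <= 2 * s by lra.
rewrite ger0_norm ?invr_ge0; last lra.
have : (2 * s)^-1 * N (quad c v) <= N (quad c v).
  by rewrite ler_piMl// invf_le1//; lra.
lra.
Qed.

(** The coefficients c are not passed to the limit: T^2 a + a is approximated by points of the
    closed subspace M + R T a, and membership there supplies t. *)
Lemma quad_point z : ~ M z ->
  exists (t : R) a, [/\ A a, far (1 / 4) a M & M (quad t a)].
Proof.
move=> Mz.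
have /choice[p pP] : forall j : nat, exists p : R * V, exists m,
    [/\ `|p.1| <= 2, A p.2, far (1 / 2 - j.+1%:R^-1) p.2 M, M m
      & N (quad p.1 p.2 - m) < j.+1%:R^-1].
  move=> j; have [|c [a [m H]]] := @approx_quad_point z j.+1%:R^-1 Mz.
    by rewrite invr_gt0.
  by exists (c, a), m.
have [|a Aa aP] := A_cluster (u := fun j => (p j).2).
  by move=> j; have [m []] := pP j.
have near (e : R) : 0 < e -> exists j : nat,
    j.+1%:R^-1 < e /\ N ((p j).2 - a) < e.
  move=> e0; have [K KP] := natSinv_lt e0; have [j Kj jP] := aP _ e0 K.
  by exists j; split => //; exact: KP.
have : add_line M (T a) (T (T a) + a).
  apply: (fsub_closed (add_line_fin_subspace fM (T a))) => e e0.
  have [|j [j1 j2]] := near (e / 5); first by rewrite divr_gt0.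
  have [m [c2 _ _ Mm mP]] := pP j.
  exists (m + (p j).1 *: T a); first by exists (p j).1; rewrite addrK.
  have -> : T (T a) + a - (m + (p j).1 *: T a) = quad (p j).1 a - m.
    by rewrite opprD (addrC (- m)) addrA.
  have := NBD (quad (p j).1 a) (quad (p j).1 (p j).2) m.
  rewrite -quadB; have := N_quad (a - (p j).2) c2; rewrite (NB a).
  have := lt_trans mP j1; lra.
move=> [t Mt]; exists t, a; split => //.
(* The constants give 1/2 - 1/8 - 1/8 = 1/4. *)
move=> b Mb; have [|j [j1 j2]] := near (1 / 8); first by rewrite divr_gt0.
have [m [_ _ /(_ _ Mb) + _ _]] := pP j.
by move: j1 (NBD (p j).2 a b); move: _^-1 => u; lra.
Qed.

Lemma tame_extend z : ~ M z -> exists M' a,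
  [/\ tame M', M `<=` M', M' a, A a & far (1 / 4) a M].
Proof.
move=> /quad_point[t [a [Aa fara Mq]]].
have f1 := add_line_fin_subspace fM a.
have f2 := add_line_fin_subspace f1 (T a).
pose M' := add_line (add_line M a) (T a).
have MM' : M `<=` M' by move=> x Mx; do 2 apply: sub_add_line => //.
have M'a : M' a by apply: sub_add_line => //; exact: mem_add_line.
have M'Ta : M' (T a) by exact: mem_add_line.
have M'TTa : M' (T (T a)).
  have -> : T (T a) = quad t a + t *: T a - a by rewrite /quad subrK addrK.
  by apply: fsubB => //; apply: fsubD => //; [exact: MM'|exact: fsubZ].
have M'E x : M' x -> exists s r m, M m /\ x = m + r *: a + s *: T a.
  move=> [s [r Mm]]; exists s, r, (x - s *: T a - r *: a); split => //.
  by rewrite !subrK.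
exists M', a; split => //; split => // x /M'E[s [r [m [Mm ->]]]].
  rewrite !(linearD T) !(linearZ_LR T).
  apply: (fsubD f2); last exact: fsubZ.
  apply: (fsubD f2); last exact: fsubZ.
  by apply: MM'; exact: tame_inv.
have [m0 Mm0 m0E] := tame_onto tM Mm.
have [q Mq' qE] := tame_onto tM Mq.
(* With T q = [quad t a], the vector t a - T a + q is a preimage of [a]; a preimage of T a is [a]
   itself. *)
exists (m0 + r *: (t *: a - T a + q) + s *: a).
  apply: (fsubD f2); last exact: fsubZ.
  apply: (fsubD f2); first exact: MM'.
  apply: (fsubZ f2); apply: (fsubD f2); last exact: MM'.
  by apply: (fsubB f2) => //; exact: fsubZ.
rewrite !(linearD T) !(linearZ_LR T) (linearD T) (linearB T) (linearZ_LR T).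
rewrite m0E qE.
have -> // : t *: T a - T (T a) + quad t a = a.
rewrite /quad; move: (t *: T a) (T (T a)) => u w.
by rewrite -[w + a - u]addrA [LHS]addrA subrK addrC subrK.
Qed.

End Step.

(** * The infinite chain of subspaces *)

Lemma tame_set0 : tame [set 0].
Proof.
split; first exact: set0_fin_subspace.
- by move=> x ->; rewrite /= linear0.
- by move=> x ->; exists 0; rewrite ?linear0.
Qed.

Lemma tame_proper M : ~ finite_dimensional V -> tame M -> exists z, ~ M z.
Proof.
move=> infV [fM _ _]; apply: contrapT => H; apply: infV.
have [n [e eP]] := fsub_span fM; exists n, e => v; apply: eP.
by apply: contrapT => nMv; apply: H; exists v.
Qed.

Lemma attracting_finite_dimensional : finite_dimensional V.
Proof.
apply: contrapT => infV.
pose S := {M : set V | tame M}.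
have /choice[F FP] : forall M : S, exists p : S * V,
    [/\ sval M `<=` sval p.1, sval p.1 p.2, A p.2
      & far (1 / 4) p.2 (sval M)].
  move=> [M tM] /=; have [z nMz] := tame_proper infV tM.
  have [M' [a [tM' ? ? ? ?]]] := tame_extend tM nMz.
  by exists (exist _ M' tM', a).
pose C n : S := iter n (fun M => (F M).1) (exist _ _ tame_set0).
have C_le i j : (i <= j)%N -> sval (C i) `<=` sval (C j).
  move=> /subnK <-; elim: (j - i)%N => // k IH x Cx.
  by have [+ _ _ _] := FP (C (k + i)%N); apply; exact: IH.
have [|a _ aP] := A_cluster (u := fun n => (F (C n)).2).
  by move=> n; have [] := FP (C n).
(* Two chosen points within 1/8 of a cluster point are less than 1/4 apart. But for i < j the i-th
   point lies in [C i.+1], hence in [C j], from which the j-th has distance at least 1/4. *)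
have e8 : 0 < 1 / 8 :> R by rewrite divr_gt0.
have [i _ iP] := aP _ e8 0%N; have [j ij jP] := aP _ e8 i.+1.
have [_ _ _ /(_ (F (C i)).2)] := FP (C j).
have [_ Ci _ _] := FP (C i) => /(_ (C_le _ _ ij _ Ci)).
have := NBD (F (C j)).2 a (F (C i)).2; rewrite (NB a); lra.
Qed.

End Core.

(** * Restriction of scalars and transfer to Banach spaces *)

(* A copy of X, so that its R-module structure does not clash with the
   K-module structure of X. *)
Definition scalar_restriction (R : realType) (K : numFieldType)
  (iota : {rmorphism R -> K}) (X : lmodType K) : Type := X.

Section Restriction.
Variables (R : realType) (K : numFieldType) (iota : {rmorphism R -> K}).
Variable X : lmodType K.
Local Notation XR := (scalar_restriction iota X).
HB.instance Definition _ := GRing.Zmodule.on XR.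

Let scale (r : R) (x : XR) : XR := iota r *: (x : X).

Let scaleA a b v : scale a (scale b v) = scale (a * b) v.
Proof. by rewrite /scale scalerA rmorphM. Qed.
Let scale1 : left_id 1 scale.
Proof. by move=> v; rewrite /scale rmorph1 scale1r. Qed.
Let scaleDr : right_distributive scale +%R.
Proof. by move=> a u v; rewrite /scale scalerDr. Qed.
Let scaleDl v : {morph scale^~ v : a b / a + b}.
Proof. by move=> a b; rewrite /scale rmorphD scalerDl. Qed.

HB.instance Definition _ :=
  GRing.Zmodule_isLmodule.Build R XR scaleA scale1 scaleDr scaleDl.

Lemma restr_scaleE (r : R) (x : XR) : r *: x = iota r *: (x : X).
Proof. by []. Qed.

Lemma finite_dimensional_restriction :
  finite_dimensional XR -> finite_dimensional X.
Proof.
move=> [n [e eP]]; exists n, e => v; have [a ->] := eP v.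
by exists (iota \o a).
Qed.

End Restriction.

Section RestrictionMap.
Variables (R : realType) (K : numFieldType) (iota : {rmorphism R -> K}).
Variables (X : lmodType K) (T : {linear X -> X}).
Local Notation XR := (scalar_restriction iota X).

Definition restr_map (x : XR) : XR := T (x : X).

Let restr_map_linear : linear restr_map.
Proof. by move=> r x y; rewrite /restr_map !restr_scaleE linearP. Qed.

HB.instance Definition _ :=
  GRing.isLinear.Build R XR XR *:%R restr_map restr_map_linear.

End RestrictionMap.

Lemma rho_lt (R : realType) (K : numFieldType) (re : K -> R)
    (X : normedModType K) (x : X) (A : set X) (e : R) :
  (rho re x A < e%:E)%E -> exists2 a, A a & re `|x - a| < e.
Proof. by move=> /ereal_inf_lt[_ [a Aa <-]]; rewrite lte_fin; exists a. Qed.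

(** The lower limit is the supremum of the tail infima, so every tail has infimum below l. *)
Lemma limn_einf_frequently_lt (R : realType) (u : (\bar R)^nat) (l : \bar R) :
  (limn_einf u < l)%E -> forall n, exists2 k, (n <= k)%N & (u k < l)%E.
Proof.
rewrite limn_einf_lim => ul n.
have : (einfs u n < l)%E.
  apply: le_lt_trans ul; rewrite (cvg_lim _ (@cvg_einfs_sup _ u))//.
  by apply: ereal_sup_ubound; exists n.
by move=> /ereal_inf_lt[_ [k nk <-]]; exists k.
Qed.

(** The conditions on [iota] and [re] make [re] of the norm a real norm that [iota] sends back to
    the original one, which covers real and complex scalars together. *)
Lemma isometry_attracting_finite_dimensional (R : realType)
    (K : numFieldType) (iota : {rmorphism R -> K}) (re : K -> R)
    (iota_le : {mono iota : r s / r <= s})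
    (iota_re : forall k, 0 <= k -> iota (re k) = k)
    (X : normedModType K) (T : {linear X -> X}) (A : set X) :
  linear_isometry T -> compact A -> occasionally_attracting re T A ->
  finite_dimensional X.
Proof.
move=> isoT cA attA.
have iota_lt : {mono iota : r s / r < s} := leW_mono iota_le.
pose N (x : scalar_restriction iota X) : R := re `|x : X|.
have iotaN x : iota (N x) = `|x : X| by rewrite iota_re.
have iota_norm r : `|iota r| = iota `|r|.
  have [r0|r0] := leP 0 r.
    by rewrite !ger0_norm// -(rmorph0 iota) iota_le.
  by rewrite !ltr0_norm ?rmorphN// -(rmorph0 iota) iota_lt.
have iota_inj : injective iota := inc_inj iota_le.
apply: (@finite_dimensional_restriction _ _ iota).
apply: (@attracting_finite_dimensional R (scalar_restriction iota X) N
  _ _ _ (@restr_map R K iota X T) _ A).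
- by move=> x y; rewrite -iota_le rmorphD/= !iotaN ler_normD.
- move=> r x; apply: iota_inj.
  by rewrite rmorphM/= -iota_norm !iotaN normrZ.
- move=> x /(congr1 iota); rewrite iotaN rmorph0 => /eqP.
  by rewrite normr_eq0 => /eqP.
- by move=> x; rewrite /N isoT.
- move=> u Au.
  have [|a [Aa cl]] := cA (u @ \oo) _; first by exists 0%N => // k _; exact: Au.
  exists a => // e e0 n.
  have [] := cl [set u k | k in [set k | (n <= k)%N]] (ball a (iota e)).
  + by exists n => // k /= nk; exists k.
  + by apply: nbhsx_ballx; rewrite -(rmorph0 iota) iota_lt.
  + move=> x [[k /= nk <-]]; rewrite -ball_normE /= distrC => ke.
    by exists k => //; rewrite -iota_lt iotaN.
- move=> x x1 e e0 n.
  have {}x1 : `|x : X| <= 1 by rewrite -iotaN -(rmorph1 iota) iota_le.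
  have rho_e : (limn_einf (fun n => rho re (iter n T x) A) < e%:E)%E.
    by rewrite (attA _ x1) lte_fin.
  have [k nk /rho_lt[a Aa ka]] := limn_einf_frequently_lt rho_e n.
  by exists k, a; split.
Qed.

Theorem theorem1 (R : realType) :
  (forall (X : completeNormedModType R) (T : {linear X -> X}),
      ~ finite_dimensional X -> linear_isometry T ->
      ~ exists A : set X,
          compact A /\ occasionally_attracting (fun r : R => r) T A) /\
  (forall (X : completeNormedModType R[i]) (T : {linear X -> X}),
      ~ finite_dimensional X -> linear_isometry T ->
      ~ exists A : set X,
          compact A /\ occasionally_attracting (@complex.Re R) T A).
Proof.
split=> X T infX isoT [A [cA attA]]; apply: infX.
- exact: (@isometry_attracting_finite_dimensional R R idfun _ _ _ X T A).
- apply: (@isometry_attracting_finite_dimensional R R[i] (real_complex R)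
    (@complex.Re R) _ _ X T A) => //.
  + by move=> r s; rewrite lecR.
  + by move=> k k0; apply: RRe_real; exact: ger0_real.
Qed.
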